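(* Let $\lambda>0$ and let the knowledge points form a homogeneous Poisson point process of intensity $\lambda$ on $\mathbb{R}$. Let $X^*$ be the length of the gap (the interval between two consecutive knowledge points) that contains a uniformly drawn task location. Then $X^*$ has the length-biased density $$f_{X^*}(x)=\lambda^2 x e^{-\lambda x},\qquad x\ge 0,$$ i.e. $X^*\sim\mathrm{Gamma}(2,\lambda)$ (shape $2$, rate $\lambda$), and $\mathbb{E}[X^*]=2/\lambda$.
   Context: A uniformly drawn task location is a random variable uniformly distributed on some bounded interval of $\mathbb{R}$ of positive length, independent of the Poisson point process. Consecutive knowledge points are adjacent points of the Poisson process; almost surely the task location is not itself a knowledge point, so the gap containing it is well defined. *)

(* Defs.v *)
From HB Require Import structures.
From mathcomp Require Import all_boot all_order all_algebra.
From mathcomp Require Import all_classical all_reals all_analysis.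
From mathcomp Require Import measurable_realfun.

Set Implicit Arguments.
Unset Strict Implicit.
Unset Printing Implicit Defensive.

Import Order.TTheory GRing.Theory Num.Theory.
Import numFieldNormedType.Exports.

Local Open Scope classical_set_scope.
Local Open Scope ring_scope.

Section point_processes.
Context d (T : measurableType d) (R : realType) (P : probability T R).

(** A simple point process is given by its random set of points
    [Pi : T -> set R]; [npoints Pi A] is the number of points falling in [A]. *)
Definition npoints (Pi : T -> set R) (A : set R) (w : T) : \bar R :=
  counting (Pi w `&` A).

(** Subfamilies are covered by taking some of the [B i] to be [setT]. *)
Definition mutually_independent n (X : 'I_n -> T -> \bar R) : Prop :=
  forall B : 'I_n -> set (\bar R), (forall i, measurable (B i)) ->
    P (\bigcap_i (X i @^-1` B i)) = (\prod_(i < n) fine (P (X i @^-1` B i)))%:E.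

(** The Poisson probabilities are written out because [poisson_pmf] is
    constantly 1, hence not a probability mass function, at parameter 0, which
    occurs here for Lebesgue-null sets. *)
Record poisson_point_process (lambda : R) (Pi : T -> set R) : Prop := {
  ppp_locally_finite : forall w a b, finite_set (Pi w `&` `[a, b]) ;
  ppp_measurable : forall A, measurable A ->
    measurable_fun setT (npoints Pi A) ;
  ppp_poisson : forall (A : set R) (m : R) (k : nat), measurable A ->
    lebesgue_measure A = m%:E ->
    P (npoints Pi A @^-1` [set k%:R%:E]) =
      (expR (- (lambda * m)) * (lambda * m) ^+ k / k`!%:R)%:E ;
  ppp_independent : forall n (A : 'I_n -> set R),
    (forall i, measurable (A i)) -> trivIset setT A ->
    mutually_independent (fun i => npoints Pi (A i)) }.

(** The sigma-algebra generated by the point process. *)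
Definition sigma_points (Pi : T -> set R) : set (set T) :=
  <<s [set E | exists A B, [/\ measurable A, measurable B &
                 E = npoints Pi A @^-1` B]] >>.

Definition independent_of_points (Pi : T -> set R) (U : T -> R) : Prop :=
  forall (E : set T) (B : set R), sigma_points Pi E -> measurable B ->
    P (E `&` U @^-1` B) = (P E * P (U @^-1` B))%E.

Definition has_density (X : T -> R) (f : R -> R) : Prop :=
  forall B : set R, measurable B ->
    P (X @^-1` B) = (\int[lebesgue_measure]_(x in B) (f x)%:E)%E.

End point_processes.

Section gaps.
Context (R : realType).

Definition consecutive (S : set R) (l r : R) : Prop :=
  [/\ S l, S r, l < r & forall x, l < x < r -> ~ S x].

Definition gap_around (S : set R) (u l r : R) : Prop :=
  consecutive S l r /\ l < u < r.

(** There is at most one gap around [u]; the value is 0 when there is none, in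
    particular when [u] is itself a point of [S]. *)
Definition gap_length (S : set R) (u : R) : R :=
  xget 0 [set x | exists l r, gap_around S u l r /\ x = r - l].

End gaps.

Section densities.
Context (R : realType).

Definition length_biased (f : R -> R) (x : R) : R :=
  x * f x / (\int[lebesgue_measure]_y (y * f y)).

Definition gamma_fun (a : R) : R :=
  \int[lebesgue_measure]_(t in `]0, +oo[) (t `^ (a - 1) * expR (- t)).

(** [a] is the shape and [r] the rate. *)
Definition gamma_pdf (a r x : R) : R :=
  if 0 <= x then
    r `^ a / gamma_fun a * x `^ (a - 1) * expR (- (r * x))
  else 0.

End densities.

(* Main.v *)
Require Import Defs.
From HB Require Import structures.
From mathcomp Require Import all_boot all_order all_algebra.
From mathcomp Require Import all_classical all_reals all_analysis.
From mathcomp Require Import measurable_realfun.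
From mathcomp Require Import finmap ring lra.

Set Implicit Arguments.
Unset Strict Implicit.
Unset Printing Implicit Defensive.

Import Order.TTheory GRing.Theory Num.Theory.
Import numFieldNormedType.Exports.

Local Open Scope classical_set_scope.
Local Open Scope ring_scope.

(** For a fixed location [u], let [L] and [R] be the distances from [u] to the
nearest knowledge points on each side. The void probabilities of the process
alone give [P(L > s, R > t) = exp(-lambda (s + t))]; cutting the range of [L]
into [n] slices sandwiches [P(L + R > x)] between sums of void probabilities
that both tend to [(1 + lambda x) exp(-lambda x)]. This does not depend on [u],
so it carries over to the independent location [U] by rounding [U] to a grid:
rounding changes the gap only when the grid cell of [U] contains a point, an
event whose probability vanishes with the mesh. The tail then determines the
density and the mean. *)

(** * Deterministic geometry of gaps in locally finite sets *)

Section gaps_of_locally_finite_sets.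
Context (R : realType).
Implicit Types (S : set R) (u l r s t x : R).

Lemma finite_set_max S : finite_set S -> S !=set0 ->
  exists2 m, S m & forall x, S x -> x <= m.
Proof.
move=> /finite_setP[n]; elim: n S => [S|n ih S Sn [x Sx]].
  by rewrite II0 card_eq0 => /eqP -> [].
move: Sn => /eq_cardSP[y Sy Sn].
have [S0|/set0P S0] := eqVneq (S `\ y) set0.
  exists y => // z Sz; apply: contrapT => /negP zy.
  have : (S `\ y) z by split => //= zy'; rewrite zy' lexx in zy.
  by rewrite S0.
have [m [Sm _] mP] := ih _ Sn S0.
exists (Num.max m y); first by rewrite /Num.max; case: ifP.
move=> z Sz; have [->|/eqP zy] := eqVneq z y; first by rewrite le_max lexx orbT.
by rewrite le_max mP.
Qed.

Lemma finite_set_min S : finite_set S -> S !=set0 ->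
  exists2 m, S m & forall x, S x -> m <= x.
Proof.
move=> fS [y Sy].
have [||m [z Sz <-] mP] := @finite_set_max (-%R @` S).
- exact: finite_image.
- by exists (- y); exists y.
- by exists z => // x Sx; rewrite -lerN2; apply: mP; exists x.
Qed.

Lemma gap_around_uniq S u l r l' r' :
  gap_around S u l r -> gap_around S u l' r' -> l = l' /\ r = r'.
Proof.
move=> [[Sl Sr lr nS] /andP[lu ur]] [[Sl' Sr' lr' nS'] /andP[lu' ur']].
split; apply/eqP; rewrite eq_le; apply/andP; split; rewrite leNgt; apply/negP => h.
- by apply: (nS' l) => //; rewrite h (lt_trans lu).
- by apply: (nS l') => //; rewrite h (lt_trans lu').
- by apply: (nS r') => //; rewrite h andbT (lt_trans lu).
- by apply: (nS' r) => //; rewrite h andbT (lt_trans lu').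
Qed.

Lemma gap_lengthE S u l r : gap_around S u l r -> gap_length S u = r - l.
Proof.
move=> g; rewrite /gap_length; apply: xget_unique; first by exists l, r.
by move=> _ [l' [r' [/(gap_around_uniq g)[-> ->] ->]]].
Qed.

Lemma gap_length_ge0 S u : 0 <= gap_length S u.
Proof.
rewrite /gap_length; case: xgetP => // _ _ [l [r [[[_ _ lr _] _] ->]]].
by rewrite subr_ge0 ltW.
Qed.

Lemma gap_length_gt0 S u :
  0 < gap_length S u <-> exists l r, gap_around S u l r.
Proof.
split=> [|[l [r g]]]; last first.
  by rewrite (gap_lengthE g) subr_gt0; case: g => -[].
rewrite {1}/gap_length; case: xgetP => [_ _ [l [r [g _]]] _|_]; first by exists l, r.
by rewrite ltxx.
Qed.

(** No point of [S] separates two locations of a void interval, so both see the same gap. This is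
    what makes rounding within a void grid cell harmless. *)
Lemma eq_gap_length S s t u c : S `&` `[s, t] = set0 ->
  s <= u <= t -> s <= c <= t -> gap_length S u = gap_length S c.
Proof.
move=> S0 ust cst.
have out p : S p -> (p < s) || (t < p).
  move=> Sp; rewrite -[_ || _]negbK negb_or -!leNgt; apply/negP => pst.
  by have : (S `&` `[s, t]) p; [split => //=; rewrite in_itv|rewrite S0].
have aux v w l r : s <= v <= t -> s <= w <= t ->
    gap_around S v l r -> gap_around S w l r.
  move=> /andP[sv vt] /andP[sw wt] [[Sl Sr lr nS] /andP[lv vr]].
  split => //; apply/andP; split.
  - by case/orP: (out _ Sl) => h; lra.
  - by case/orP: (out _ Sr) => h; lra.
congr (xget _ _); apply/seteqP; split => x [l [r [g ->]]]; exists l, r; split => //.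
- exact: aux ust cst g.
- exact: aux cst ust g.
Qed.

(** The gap ends are the last point of [S] in [[p, s]] and the first in [[t, q]], with [p] and [q]
    the given points on either side; local finiteness makes both exist. Strictness comes from the
    void interval being closed. *)
Lemma gap_around_void S s t u :
    (forall a b, finite_set (S `&` `[a, b])) ->
    s <= u <= t -> S `&` `[s, t] = set0 ->
    S `&` `]-oo, s] !=set0 -> S `&` `[t, +oo[ !=set0 ->
  exists l r, [/\ gap_around S u l r, l < s & t < r].
Proof.
move=> lfS /andP[su ut] S0 [p [Sp]] + [q [Sq]].
rewrite /= !in_itv/= andbT => ps tq.
have [|l [Sl +] lP] := finite_set_max (lfS p s).
  by exists p; split => //=; rewrite in_itv/= lexx.
have [|r [Sr +] rP] := finite_set_min (lfS t q).
  by exists q; split => //=; rewrite in_itv/= lexx andbT.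
rewrite /= !in_itv/= => /andP[tr rq] /andP[pl ls].
have out x : S x -> s <= x <= t -> False.
  by move=> Sx xst; have : (S `&` `[s, t]) x; [split => //=; rewrite in_itv|rewrite S0].
have {}ls : l < s.
  rewrite lt_neqAle ls andbT; apply/eqP => lse.
  by apply: (out _ Sl); rewrite lse lexx (le_trans su).
have {}tr : t < r.
  rewrite lt_neqAle tr andbT; apply/eqP => tre.
  by apply: (out _ Sr); rewrite -tre lexx (le_trans su).
exists l, r; split => //; split; last by rewrite (lt_le_trans ls) // (le_lt_trans ut).
split => //; first by lra.
move=> x /andP[lx xr] Sx.
have [xs|sx] := leP x s.
  have : x <= l by apply: lP; split => //=; rewrite in_itv/= xs andbT; lra.
  lra.
have [tx|xt] := leP t x.
  have : r <= x by apply: rP; split => //=; rewrite in_itv/= tx; lra.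
  lra.
by apply: (out _ Sx); rewrite (ltW sx) ltW.
Qed.

(** Rational end points turn the event into a countable union of events on the process and [u]. The
    weak inequality on [ratr t - ratr s] suffices because the gap strictly contains the void
    interval. *)
Lemma gap_length_gtP S u x : (forall a b, finite_set (S `&` `[a, b])) -> 0 <= x ->
  x < gap_length S u <-> exists s t : rat,
    [/\ ratr s <= u <= ratr t, x <= ratr t - ratr s,
        S `&` `[ratr s, ratr t] = set0,
        S `&` `]-oo, ratr s] !=set0 & S `&` `[ratr t, +oo[ !=set0].
Proof.
move=> lfS x0; split; last first.
  move=> [s [t [sut xst S0 Sl Sr]]].
  have [l [r [g ls tr]]] := gap_around_void lfS sut S0 Sl Sr.
  by rewrite (gap_lengthE g); lra.
move=> xg; have [l [r g]] : exists l r, gap_around S u l r.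
  by apply/gap_length_gt0; exact: le_lt_trans xg.
move: xg; rewrite (gap_lengthE g) => xg.
case: g => -[Sl Sr lr nS] /andP[lu ur].
(* [(l + r - x) / 2] and [(l + r + x) / 2] are the ends of the segment of length [x] centred in the
   gap; [s] and [t] are taken beyond them and on either side of [u]. *)
have [s /itvP ls] : exists s : rat, ratr s \in `]l, Num.min u ((l + r - x) / 2)[.
  by apply: rat_in_itvoo; rewrite lt_min lu/=; lra.
have [t /itvP tr] : exists t : rat, ratr t \in `]Num.max u ((l + r + x) / 2), r[.
  by apply: rat_in_itvoo; rewrite gt_max ur/=; lra.
have : ratr s < Num.min u ((l + r - x) / 2) by rewrite ls.
have : Num.max u ((l + r + x) / 2) < ratr t by rewrite tr.
rewrite lt_min gt_max => /andP[ut rt] /andP[su sl].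
exists s, t; split.
- by rewrite !ltW.
- lra.
- apply/seteqP; split => // y [Sy /=]; rewrite in_itv/= => /andP[sy yt].
  by apply: (nS y) => //; rewrite (lt_le_trans _ sy) ?ls// (le_lt_trans yt) ?tr.
- by exists l; split => //=; rewrite in_itv/= ltW// ls.
- by exists r; split => //=; rewrite in_itv/= andbT ltW// tr.
Qed.

End gaps_of_locally_finite_sets.

(** * Measurability of the gap length *)

Section measurability.
Context d (T : measurableType d) (R : realType) (Pi : T -> set R) (U : T -> R).
Hypothesis lfPi : forall w a b, finite_set (Pi w `&` `[a, b]).
Hypothesis mPi : forall A, measurable A -> measurable [set w | Pi w `&` A = set0].
Hypothesis mU : measurable_fun setT U.

(** The only measurability asked of the process is that of void events, so this applies both to the
    ambient sigma-algebra and to the one generated by the points. *)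
Lemma measurable_gap_length_gt x :
  measurable [set w | x < gap_length (Pi w) (U w)].
Proof.
have [x0|x0] := leP 0 x; last first.
  rewrite (_ : [set w | _] = setT) //; apply/seteqP; split => // w _ /=.
  exact: lt_le_trans (gap_length_ge0 _ _).
pose E (s t : rat) : set T :=
  U @^-1` `[ratr s, ratr t] `&`
  [set w | Pi w `&` `[ratr s, ratr t] = set0] `&`
  ~` [set w | Pi w `&` `]-oo, ratr s] = set0] `&`
  ~` [set w | Pi w `&` `[ratr t, +oo[ = set0].
rewrite (_ : [set w | _] =
  \bigcup_s \bigcup_t if x <= ratr t - ratr s then E s t else set0); last first.
  apply/seteqP; split => w /=.
    move=> /gap_length_gtP -/(_ (@lfPi w) x0)[s [t [sut xst S0 Sl Sr]]].
    exists s => //; exists t => //; rewrite xst; split.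
      split; last exact/eqP/set0P.
      by split => //=; rewrite in_itv.
    exact/eqP/set0P.
  move=> [s _ [t _]]; case: ifPn => // xst [[[/= sut S0] Sl] Sr].
  apply/(gap_length_gtP _ (@lfPi w) x0); exists s, t; split => //.
  - exact/set0P/eqP.
  - exact/set0P/eqP.
apply: bigcupT_measurable_rat => s; apply: bigcupT_measurable_rat => t.
case: ifPn => // _; apply: measurableI; [apply: measurableI|]; [apply: measurableI| |].
- by rewrite -[X in measurable X]setTI; exact: mU.
- exact: mPi.
- exact/measurableC/mPi.
- exact/measurableC/mPi.
Qed.

Lemma measurable_gap_length :
  measurable_fun setT (fun w => gap_length (Pi w) (U w)).
Proof.
apply: (measurability _ (RGenOInfty.measurableE R)) => //= _ [_ [x ->] <-].
rewrite setTI (_ : _ @^-1` _ = [set w | x < gap_length (Pi w) (U w)]).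
  exact: measurable_gap_length_gt.
by apply/seteqP; split => w /=; rewrite in_itv/= andbT.
Qed.

End measurability.

(** * Integrals of an affine function times a decaying exponential *)

Section affine_exponential.
Context (R : realType).
Implicit Types (lambda p q x y : R).

(** Since [exp z >= z^2 / 2] for [z >= 0], the product is at most [2 / (lambda^2 y)]. *)
Lemma cvg_mul_expRN lambda : 0 < lambda ->
  y * expR (- (lambda * y)) @[y --> +oo] --> (0 : R).
Proof.
move=> l0.
apply: (@squeeze_cvgr _ _ _ _ (cst 0) (fun y => 2 / lambda ^+ 2 * y^-1)).
- near=> y; have y0 : 0 < y by near: y; exact: nbhs_pinfty_gt.
  rewrite mulr_ge0 ?expR_ge0 ?(ltW y0)//= expRN.
  rewrite ler_pdivrMr ?expR_gt0//.
  have := @expR_ge1Dxn _ (lambda * y) 1 (mulr_ge0 (ltW l0) (ltW y0)).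
  rewrite (_ : 2`! = 2)// => h.
  apply: (@le_trans _ _ (2 / lambda ^+ 2 / y * ((lambda * y) ^+ 2 / 2))).
    by rewrite le_eqVlt; apply/orP; left; apply/eqP; field; rewrite !gt_eqF.
  rewrite ler_wpM2l//; first by rewrite !mulr_ge0 ?invr_ge0 ?exprn_ge0// ltW.
  lra.
- exact: cvg_cst.
- rewrite -(mulr0 (2 / lambda ^+ 2)); apply: cvgMr.
  apply/gtr0_cvgV0; last exact: cvg_id.
  by near=> y; near: y; exact: nbhs_pinfty_gt.
Unshelve. all: by end_near. Qed.

Lemma cvg_expRNM lambda : 0 < lambda ->
  expR (- (lambda * y)) @[y --> +oo] --> (0 : R).
Proof.
move=> l0; apply: (@cvg_comp _ _ _ ( *%R lambda) (fun z => expR (- z)) _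
  (pinfty_nbhs R)); last exact: cvgr_expR.
exact: gt0_cvgMry.
Qed.

(** [F] is an antiderivative vanishing at infinity. This one formula yields the Gamma tail, the
    exponential mean, [gamma_fun 2] and the expectation. *)
Lemma integral_affine_expR lambda p q x : 0 < lambda -> 0 <= p -> 0 <= q -> 0 <= x ->
  (\int[lebesgue_measure]_(y in `[x, +oo[)
     ((p + q * y) * expR (- (lambda * y)))%:E)%E =
  ((p / lambda + q / lambda ^+ 2 + q * x / lambda) * expR (- (lambda * x)))%:E.
Proof.
move=> l0 p0 q0 x0.
pose f y := (p + q * y) * expR (- (lambda * y)).
pose F y := - ((p / lambda + q / lambda ^+ 2 + q / lambda * y) * expR (- (lambda * y))).
have dF y : is_derive y 1 F (f y).
  rewrite /F; apply: is_derive_eq.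
  rewrite /f /GRing.scale/=.
  by field; rewrite gt_eqF.
have cF : continuous F.
  by move=> y; apply: differentiable_continuous; apply/derivable1_diffP.
have cf : continuous f.
  move=> y; apply: differentiable_continuous; apply/derivable1_diffP.
  by apply: ex_derive.
rewrite (@ge0_continuous_FTC2y _ f F x 0) //.
- by rewrite -EFinB; congr EFin; rewrite /F; ring.
- by move=> y xy; rewrite mulr_ge0 ?expR_ge0// addr_ge0// mulr_ge0// (le_trans x0).
- exact: continuous_subspaceT.
- rewrite -oppr0 /F; apply: cvgN.
  rewrite (_ : (fun y => _) = fun y =>
    (p / lambda + q / lambda ^+ 2) * expR (- (lambda * y)) +
    q / lambda * (y * expR (- (lambda * y)))); last first.
    by apply/funext => y; ring.
  have -> : 0 = (p / lambda + q / lambda ^+ 2) * 0 + q / lambda * 0 :> R by ring.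
  by apply: cvgD; apply: cvgMr; [exact: cvg_expRNM|exact: cvg_mul_expRN].
- by apply/cvg_at_right_filter; exact: cF.
- by move=> y _; rewrite derive1E; apply: derive_val.
Qed.

End affine_exponential.

(** * Elementary inequalities for letting the number of slices grow *)

Lemma le_of_forall_leD_divn (R : realType) (a b K M : R) :
  (forall n : nat, (0 < n)%N -> M <= n%:R -> a <= b + K / n%:R) -> a <= b.
Proof.
move=> h; apply/ler_addgt0Pr => e e0.
pose n := (Num.truncn (`|K| / e + `|M|)).+1.
have n0 : 0 < n%:R :> R by rewrite ltr0n.
have Kn : `|K| / e + `|M| < n%:R by rewrite truncnS_gt.
have Ke : 0 <= `|K| / e by rewrite divr_ge0// ltW.
apply: (le_trans (h n _ _)) => //.
  by rewrite (le_trans (ler_norm M))// (le_trans _ (ltW Kn))// lerDr.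
rewrite lerD2l ler_pdivrMr// (le_trans (ler_norm K))// mulrC -ler_pdivrMr//.
by rewrite (le_trans _ (ltW Kn))// lerDl.
Qed.

(** [(1 - y + y^2) (1 + y) = 1 + y^3 >= 1], and [1 + y <= exp y]. At [y = c / n] the quadratic
    error, summed over [n] slices, is of order [1 / n]. *)
Lemma expRN_le_quadratic (R : realType) (y : R) : 0 <= y -> expR (- y) <= 1 - y + y ^+ 2.
Proof.
move=> y0; rewrite expRN -[_^-1]mul1r ler_pdivrMr ?expR_gt0//.
apply: (@le_trans _ _ ((1 - y + y ^+ 2) * (1 + y))).
  by have := exprn_ge0 3 y0; nra.
by rewrite ler_wpM2l ?expR_ge1Dx//; nra.
Qed.

(** [(1 + y + 2 y^2) (1 - y) = 1 + y^2 (1 - 2 y) >= 1] for [y <= 1/2], and [1 - y <= exp (- y)]. *)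
Lemma expR_le_quadratic (R : realType) (y : R) : 0 <= y <= 2^-1 ->
  expR y <= 1 + y + 2 * y ^+ 2.
Proof.
move=> /andP[y0 y1]; rewrite -[y in expR y]opprK expRN -[_^-1]mul1r.
rewrite ler_pdivrMr ?expR_gt0//.
apply: (@le_trans _ _ ((1 + y + 2 * y ^+ 2) * (1 - y))).
  have : 0 <= y ^+ 2 * (1 - 2 * y) by rewrite mulr_ge0 ?sqr_ge0//; lra.
  nra.
by rewrite ler_wpM2l ?expR_ge1Dx//; nra.
Qed.

(** With [Q k] saying that the [k]-th grid value is still below a given number, [k] is the slice or
    cell containing that number. *)
Lemma ex_last_lt (Q : pred nat) n : Q 0 -> ~~ Q n ->
  exists k, [/\ (k < n)%N, Q k & ~~ Q k.+1].
Proof.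
move=> Q0; elim: n => [|n ih]; first by rewrite Q0.
move=> nQ; have [Qn|/ih[k [kn Qk Qk1]]] := boolP (Q n); first by exists n.
by exists k; split => //; exact: ltn_trans kn _.
Qed.

(** * Void probabilities and the gap around a fixed location *)

Section void_probabilities.
Context d (T : measurableType d) (R : realType) (P : probability T R).
Variables (lambda : R) (Pi : T -> set R).
Hypothesis lambda_gt0 : 0 < lambda.
Hypothesis ppp_Pi : poisson_point_process P lambda Pi.
Let void (A : set R) := [set w | Pi w `&` A = set0].

Let lfPi : forall w a b, finite_set (Pi w `&` `[a, b]).
Proof. exact: ppp_locally_finite ppp_Pi. Qed.

Lemma voidE (A : set R) : void A = npoints Pi A @^-1` [set 0%:R%:E].
Proof.
apply/seteqP; split => w; rewrite /void /npoints /counting /=.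
  by move=> ->; rewrite asboolT// fset_set0 cardfs0.
case: asboolP => // fA [/eqP]; rewrite pnatr_eq0 cardfs_eq0 => /eqP h.
by rewrite -(fset_setK fA) h set_fset0.
Qed.

Lemma sigma_points_void (A : set R) : measurable A -> sigma_points Pi (void A).
Proof.
move=> mA; apply: sub_sigma_algebra; exists A, [set 0%:R%:E]; split => //.
exact: voidE.
Qed.

Lemma measurable_void (A : set R) : measurable A -> measurable (void A).
Proof.
move=> mA; rewrite voidE -[X in measurable X]setTI.
exact: (ppp_measurable ppp_Pi).
Qed.

Lemma void_subset (A B : set R) : A `<=` B -> void B `<=` void A.
Proof. by move=> AB w /= B0; apply: subsetI_eq0 B0. Qed.

Lemma prob_void_itv s t : s <= t ->
  P (void `[s, t]) = (expR (- (lambda * (t - s))))%:E.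
Proof.
move=> st; rewrite voidE (@ppp_poisson _ _ _ _ _ _ ppp_Pi _ (t - s))//.
  by rewrite expr0 fact0 mulr1 divr1.
by rewrite lebesgue_measure_itv/= lte_fin; case: ltgtP st => // -> _; rewrite subrr.
Qed.

(** The event places the last point up to [b] in [[a1, a2)]; as the two void events are nested, its
    probability is a difference. *)
Lemma prob_void_slice a1 a2 b : a1 <= a2 <= b ->
  P (void `[a2, b] `\` void `[a1, b]) =
  (expR (- (lambda * (b - a2))) - expR (- (lambda * (b - a1))))%:E.
Proof.
move=> /andP[a12 ab]; rewrite measureD; try exact: measurable_void.
  rewrite setIidr; last by apply: void_subset; apply: subset_itvr; rewrite bnd_simp.
  by rewrite /= (prob_void_itv ab) (prob_void_itv (le_trans a12 ab)) EFinB.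
by rewrite -ge0_fin_numE// fin_num_measure//; exact: measurable_void.
Qed.

(** A void half-line contains void segments of every length [n], of probability
    [exp (- lambda n) <= 1 / (lambda n)]. *)
Lemma prob_void_ray (I : interval R) :
  (forall n : nat, exists s, [set` `[s, s + n%:R]] `<=` [set` I]) ->
  P (void [set` I]) = 0%E.
Proof.
move=> h; have mI := measurable_void (@measurable_itv _ I).
apply/eqP; rewrite eq_le measure_ge0 andbT -[P _]fineK ?fin_num_measure//.
rewrite lee_fin; apply: (@le_of_forall_leD_divn _ _ _ lambda^-1 0) => n n0 _.
have [s sI] := h n.
rewrite -lee_fin fineK ?fin_num_measure//.
have mJ := measurable_void (measurable_itv `[s, s + n%:R]).
apply: (le_trans (le_measure P (mem_set mI) (mem_set mJ) (void_subset sI))).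
rewrite /= prob_void_itv ?lerDl// lee_fin add0r addrAC subrr add0r expRN -invfM.
rewrite lef_pV2 ?posrE ?expR_gt0 ?mulr_gt0 ?ltr0n//.
by rewrite (le_trans _ (expR_ge1Dx _))// lerDr.
Qed.

(** Independence from the location is available on this sigma-algebra only, so the measurability
    lemma is applied with it as the structure on [T] and a constant location. *)
Lemma sigma_points_gap_length_gt u x :
  sigma_points Pi [set w | x < gap_length (Pi w) u].
Proof.
pose G := [set E | exists A B, [/\ measurable A, measurable B &
                 E = npoints Pi A @^-1` B]].
apply: (@measurable_gap_length_gt _ (g_sigma_algebraType G) R Pi (cst u)) => //.
by move=> A mA; exact: sigma_points_void.
Qed.

Let mgap u x : measurable [set w | x < gap_length (Pi w) u].
Proof.
by apply: (@measurable_gap_length_gt _ T R Pi (cst u)) => //; exact: measurable_void.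
Qed.

(* If the gap [(l, r)] exceeds [x] and [k e < u - l <= (k + 1) e] with
   [e = x / n], then [r > u + x - (k + 1) e]. *)
Lemma gap_length_gt_le u x n : 0 <= x -> (0 < n)%N ->
  (P [set w | (x < gap_length (Pi w) u)%R] <=
  (expR (- (lambda * x)) +
     n%:R * (expR (- (lambda * (x - x / n%:R))) - expR (- (lambda * x))))%:E)%E.
Proof.
move=> x0 n0; set e := x / n%:R.
have n0' : 0 < n%:R :> R by rewrite ltr0n.
have nx : n%:R * e = x by rewrite /e mulrC divfK// gt_eqF.
have e0 : 0 <= e by rewrite divr_ge0// ltW.
(* [[u - k e, B k]] has length [x - e]: the left distance is known only up to [e], and an upper
   bound must allow for that loss. *)
pose B k := u + x - k.+1%:R * e.
pose E k := void `[u - k%:R * e, B k] `\` void `[u - k.+1%:R * e, B k].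
have kn k : (k < n)%N -> k.+1%:R * e <= x by move=> ?; rewrite -nx ler_wpM2r// ler_nat.
have kS k : k.+1%:R * e = k%:R * e + e by rewrite -natr1 mulrDl mul1r.
have k0 k : 0 <= k%:R * e by rewrite mulr_ge0.
have mE k : measurable (E k) by apply: measurableD; exact: measurable_void.
have mV : measurable (void `[u - x, u]) by exact: measurable_void.
have mEs : measurable (\big[setU/set0]_(k < n) E k) by apply: bigsetU_measurable.
apply: (@le_trans _ _ (P (void `[u - x, u] `|` \big[setU/set0]_(k < n) E k))).
  apply: le_measure; [exact/mem_set/mgap|exact/mem_set/measurableU|].
  move=> w /= xg.
  have [l [r g]] : exists l r, gap_around (Pi w) u l r.
    by apply/gap_length_gt0; exact: le_lt_trans xg.
  move: xg; rewrite (gap_lengthE g); case: g => -[Sl Sr lr nS] /andP[lu ur] xg.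
  have vd s t : l < s -> t < r -> void `[s, t] w.
    move=> ls tr; apply/seteqP; split => // y [Sy /=]; rewrite in_itv/= => /andP[sy yt].
    by apply: (nS y) => //; rewrite (lt_le_trans ls)//= (le_lt_trans yt).
  (* Either the left distance alone exceeds [x], and [[u - x, u]] is void, or it falls in one of the
     [n] slices. *)
  have [ux|ux] := ltP x (u - l); first by left; apply: vd; lra.
  right; have [||k [kltn Qk Qk1]] := @ex_last_lt (fun k => k%:R * e < u - l) n.
  - by rewrite mul0r subr_gt0.
  - by rewrite -leNgt nx.
  rewrite -leNgt in Qk1.
  rewrite -bigcup_mkord; exists k => //; split.
    by apply: vd; rewrite /B; lra.
  rewrite /void/= => v0; suff : (Pi w `&` `[u - k.+1%:R * e, B k]) l by rewrite v0.
  by split => //=; rewrite in_itv/= /B; have := kn _ kltn; lra.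
apply: (le_trans (measureU2 _ _ _)) => //.
rewrite /= EFinD prob_void_itv; last lra.
rewrite (_ : u - (u - x) = x); last lra.
apply: leeD2l.
apply: (le_trans (Boole_inequality _ _)) => //.
apply: (@le_trans _ _ (\sum_(k < n) (expR (- (lambda * (x - e))) - expR (- (lambda * x)))%:E)%E).
  apply: lee_sum => -[k kltn] _; rewrite /= prob_void_slice; last first.
    by have := kn _ kltn; have := kS k; have := k0 k; rewrite /B; lra.
  have -> : B k - (u - k%:R * e) = x - e by rewrite /B kS; lra.
  by have -> : B k - (u - k.+1%:R * e) = x by rewrite /B; lra.
by rewrite sumEFin sumr_const card_ord mulr_natl.
Qed.

(* The slices [k e < u - l <= (k + 1) e], [r > u + x - k e] are disjoint and
   force the gap [(l, r)] to exceed [x]. *)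
Lemma gap_length_gt_ge u x n : 0 <= x -> (0 < n)%N ->
  ((expR (- (lambda * x)) +
     n%:R * (expR (- (lambda * x)) - expR (- (lambda * (x + x / n%:R)))))%:E <=
  P [set w | (x < gap_length (Pi w) u)%R])%E.
Proof.
move=> x0 n0; set e := x / n%:R.
have n0' : 0 < n%:R :> R by rewrite ltr0n.
have nx : n%:R * e = x by rewrite /e mulrC divfK// gt_eqF.
have e0 : 0 <= e by rewrite divr_ge0// ltW.
(* Now [[u - k e, B k]] has length exactly [x], so a gap strictly containing it exceeds [x]. *)
pose B k := u + x - k%:R * e.
pose E k := void `[u - k%:R * e, B k] `\` void `[u - k.+1%:R * e, B k].
have kn k : (k < n)%N -> k.+1%:R * e <= x by move=> ?; rewrite -nx ler_wpM2r// ler_nat.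
have kS k : k.+1%:R * e = k%:R * e + e by rewrite -natr1 mulrDl mul1r.
have k0 k : 0 <= k%:R * e by rewrite mulr_ge0.
have mE k : measurable (E k) by apply: measurableD; exact: measurable_void.
have mV : measurable (void `[u - x, u]) by exact: measurable_void.
have mEs : measurable (\big[setU/set0]_(k < n) E k) by apply: bigsetU_measurable.
(* If one side of [u] has no point, there is no gap and [gap_length] is the default 0; the inclusion
   below holds only off this null event. *)
pose N := void `]-oo, u] `|` void `[u, +oo[.
have mN : measurable N by apply: measurableU; exact: measurable_void.
have PN : P N = 0%E.
  apply/eqP; rewrite eq_le measure_ge0 andbT.
  apply: (le_trans (measureU2 _ _ _)); try exact: measurable_void.
  rewrite /= !prob_void_ray ?adde0// => m.
  - by exists u => y /=; rewrite !in_itv/= => /andP[->].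
  - by exists (u - m%:R) => y /=; rewrite !in_itv/= subrK => /andP[_ ->].
have Epoint k w : (k < n)%N -> E k w ->
    exists2 p, Pi w p & u - k.+1%:R * e <= p < u - k%:R * e.
  move=> kltn [v0 v1]; have /eqP/set0P[p [Sp]] : Pi w `&` `[u - k.+1%:R * e, B k] <> set0 by [].
  rewrite /= in_itv/= => /andP[p1 p2]; exists p => //; rewrite p1 ltNge/=.
  apply/negP => p3.
  by suff : (Pi w `&` `[u - k%:R * e, B k]) p; [rewrite v0|split => //=; rewrite in_itv/= p3].
(* The point witnessing slice [j] lies in [[u - k e, u]] when [j < k]. This separates two slices,
   and with [k = n] it separates every slice from the event that [[u - x, u]] is void. *)
have disj k w j : (j < k)%N -> (k <= n)%N -> E j w -> ~ void `[u - k%:R * e, u] w.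
  move=> jk kltn /Epoint [|p Sp /andP[p1 p2] v0]; first exact: leq_trans kltn.
  have : j.+1%:R * e <= k%:R * e by rewrite ler_wpM2r// ler_nat.
  have := k0 j => *.
  suff : (Pi w `&` `[u - k%:R * e, u]) p by rewrite v0.
  by split => //=; rewrite in_itv/=; lra.
have Evoid k w : (k < n)%N -> E k w -> void `[u - k%:R * e, u] w.
  move=> kltn [+ _]; apply: void_subset; apply: subset_itvl; rewrite bnd_simp.
  by rewrite /B; have := kn _ kltn; have := kS k; lra.
have -> : (expR (- (lambda * x)) + n%:R *
    (expR (- (lambda * x)) - expR (- (lambda * (x + e)))))%:E =
    P (void `[u - x, u] `|` \big[setU/set0]_(k < n) E k).
  rewrite measureU//; last first.
    apply/seteqP; split => // w [v0]; rewrite -bigcup_mkord => -[k /= kltn Ekw].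
    by apply: (disj n w k) => //; rewrite nx.
  rewrite measure_bigsetU_ord_cond; last 2 first.
  - by move=> k _; exact: mE.
  - apply/trivIsetP => i j _ _ ij; apply/seteqP; split => // w [Ei Ej].
    move: ij; rewrite -val_eqE neq_ltn => /orP[] h.
    + exact: (disj j w i h (ltnW (ltn_ord j)) Ei) (Evoid _ _ (ltn_ord j) Ej).
    + exact: (disj i w j h (ltnW (ltn_ord i)) Ej) (Evoid _ _ (ltn_ord i) Ei).
  rewrite /= prob_void_itv; last lra.
  rewrite (_ : u - (u - x) = x); last lra.
  rewrite EFinD; congr (_ + _)%E.
  rewrite (eq_bigr (fun=> (expR (- (lambda * x)) - expR (- (lambda * (x + e))))%:E)).
    by rewrite sumEFin sumr_const card_ord mulr_natl.
  move=> [k kltn] _; rewrite /= prob_void_slice; last first.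
    by have := kS k; have := kn _ kltn; have := k0 k; rewrite /B; lra.
  have -> : B k - (u - k%:R * e) = x by rewrite /B; lra.
  by have -> : B k - (u - k.+1%:R * e) = x + e by rewrite /B kS; lra.
rewrite -[leRHS]adde0 -PN.
apply: le_trans (measureU2 P _ _) => //.
apply: le_measure; [exact/mem_set/measurableU| |].
  by apply/mem_set/measurableU => //; exact: mgap.
move=> w vw; have [Nw|] := pselect (N w); first by right.
move=> /not_orP[/eqP/set0P[p [Sp +]] /eqP/set0P[q [Sq +]]].
rewrite /= !in_itv/= andbT => pu uq; left.
(* Every event of the union provides a void interval of length [x] around [u], which the gap then
   strictly contains. *)
have [s [t [ust xst v0]]] : exists s t, [/\ s <= u <= t, t - s = x & void `[s, t] w].
  case: vw => [v0|]; first by exists (u - x), u; split => //; lra.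
  rewrite -bigcup_mkord => -[k /= kltn [v0 _]]; exists (u - k%:R * e), (B k).
  by split => //; rewrite /B; have := kn _ kltn; have := kS k; have := k0 k; lra.
have out y : Pi w y -> ~~ (s <= y <= t).
  move=> Sy; apply/negP => sy; suff : (Pi w `&` `[s, t]) y by rewrite v0.
  by split => //=; rewrite in_itv.
have [] := @gap_around_void _ _ s t u (@lfPi w) ust v0.
- exists p; split => //=; rewrite in_itv/=; have := out _ Sp.
  by rewrite negb_and -!ltNge => /orP[]; lra.
- exists q; split => //=; rewrite in_itv/= andbT; have := out _ Sq.
  by rewrite negb_and -!ltNge => /orP[]; lra.
by move=> l [r [g ls tr]]; rewrite (gap_lengthE g); lra.
Qed.

Lemma gap_length_tail u x : 0 <= x ->
  P [set w | (x < gap_length (Pi w) u)%R] =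
  ((1 + lambda * x) * expR (- (lambda * x)))%:E.
Proof.
move=> x0; rewrite -[LHS]fineK ?fin_num_measure//; congr EFin.
set p := fine _; set c := lambda * x.
have c0 : 0 <= c by rewrite mulr_ge0// ltW.
have E0 := expR_gt0 (- c).
apply/eqP; rewrite eq_le; apply/andP; split.
(* The threshold [2 c] on [n] ensures [c / n <= 1/2], as the bound on [exp (c / n)] requires; the
   error is [n] times [2 (c / n)^2 exp (- c)]. *)
- apply: (@le_of_forall_leD_divn _ _ _ (2 * c ^+ 2 * expR (- c)) (2 * c)) => n n0 cn.
  have n0' : 0 < n%:R :> R by rewrite ltr0n.
  have := gap_length_gt_le u x0 n0; rewrite /= -[P _]fineK ?fin_num_measure//.
  rewrite lee_fin -/p -/c => /le_trans; apply.
  have -> : - (lambda * (x - x / n%:R)) = - c + c / n%:R by rewrite /c; ring.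
  have y0 : 0 <= c / n%:R by rewrite divr_ge0// ltW.
  have y1 : c / n%:R <= 2^-1 by rewrite ler_pdivrMr//; lra.
  have := @expR_le_quadratic _ (c / n%:R); rewrite y0 y1 => /(_ isT) h.
  rewrite expRD.
  have -> : (1 + c) * expR (- c) + 2 * c ^+ 2 * expR (- c) / n%:R =
    expR (- c) + n%:R * (expR (- c) * (1 + c / n%:R + 2 * (c / n%:R) ^+ 2) - expR (- c)).
    by field; rewrite gt_eqF.
  by rewrite lerD2l ler_wpM2l ?(ltW n0')// lerB// ler_wpM2l// ltW.
- apply: (@le_of_forall_leD_divn _ _ _ (c ^+ 2 * expR (- c)) 0) => n n0 _.
  have n0' : 0 < n%:R :> R by rewrite ltr0n.
  rewrite -lerBlDr.
  have := gap_length_gt_ge u x0 n0; rewrite /= -[P _]fineK ?fin_num_measure//.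
  rewrite lee_fin -/p -/c; apply: le_trans.
  have -> : - (lambda * (x + x / n%:R)) = - c - c / n%:R by rewrite /c; ring.
  have y0 : 0 <= c / n%:R by rewrite divr_ge0// ltW.
  have h := expRN_le_quadratic y0.
  rewrite expRD.
  have -> : (1 + c) * expR (- c) - c ^+ 2 * expR (- c) / n%:R =
    expR (- c) + n%:R * (expR (- c) - expR (- c) * (1 - c / n%:R + (c / n%:R) ^+ 2)).
    by field; rewrite gt_eqF.
  by rewrite lerD2l ler_wpM2l ?(ltW n0')// lerB// ler_wpM2l// ltW.
Qed.

End void_probabilities.

(** * Passage from a fixed location to the independent random one *)

Section random_location.
Context d (T : measurableType d) (R : realType) (P : probability T R).
Variables (lambda : R) (Pi : T -> set R).
Hypothesis lambda_gt0 : 0 < lambda.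
Hypothesis ppp_Pi : poisson_point_process P lambda Pi.
Variables (a b : R) (U : {RV P >-> R}).
Hypothesis ab : a < b.
Hypothesis Uab : P (U @^-1` ~` `[a, b]) = 0%E.
Hypothesis Pi_U_independent : independent_of_points P Pi U.
Let void (A : set R) := [set w | Pi w `&` A = set0].

Lemma measurable_sigma_points (E : set T) : sigma_points Pi E -> measurable E.
Proof.
apply: smallest_sub; first exact: sigma_algebra_measurable.
move=> _ [A [B [mA mB ->]]]; rewrite -[X in measurable X]setTI.
exact: (ppp_measurable ppp_Pi).
Qed.

(* Rounding [U] down to a grid of mesh [e] changes the event only if there is a
   point in the grid cell of [U], which has probability at most [lambda * e]. *)
Lemma prob_random_location_le (A : set T) (H : R -> set T) (h : R) :
  measurable A -> (forall c, sigma_points Pi (H c)) ->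
  (forall c, (P (H c) <= h%:E)%E) ->
  (forall w s t, A w -> s <= U w <= t -> void `[s, t] w -> H s w) ->
  (P A <= h%:E)%E.
Proof.
move=> mA sH Hh AH; rewrite -[P A]fineK ?fin_num_measure// lee_fin.
apply: (@le_of_forall_leD_divn _ _ _ (lambda * (b - a)) 0) => n n0 _.
have n0' : 0 < n%:R :> R by rewrite ltr0n.
pose e := (b - a) / n%:R.
have e0 : 0 < e by rewrite divr_gt0// subr_gt0.
pose c k := a + k%:R * e.
have cS k : c k.+1 = c k + e by rewrite /c -natr1; ring.
pose I k : set R := `[c k, c k.+1[%classic.
pose E k := H (c k) `|` ~` void `[c k, c k.+1].
have mUI (B : set R) : measurable B -> measurable (U @^-1` B).
  by move=> mB; rewrite -[X in measurable X]setTI; exact: measurable_funP.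
have sE k : sigma_points Pi (E k).
  pose G := [set E | exists A B, [/\ measurable A, measurable B &
                 E = npoints Pi A @^-1` B]].
  have sV := @sigma_points_void _ T R Pi `[c k, c k.+1]%classic (measurable_itv _).
  apply: (@measurableU _ (g_sigma_algebraType G) _ _ (sH (c k))).
  exact: (@measurableC _ (g_sigma_algebraType G) _ sV).
have mE k := measurable_sigma_points (sE k).
have PE k : (P (E k) <= (h + lambda * e)%:E)%E.
  have mV := @measurable_void _ T R P lambda Pi ppp_Pi `[c k, c k.+1]%classic (measurable_itv _).
  apply: (le_trans (measureU2 _ _ _)).
  - exact: measurable_sigma_points.
  - exact: measurableC.
  rewrite EFinD; apply: leeD; first exact: Hh.
  rewrite /= probability_setC// (prob_void_itv ppp_Pi); last by rewrite cS lerDl ltW.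
  rewrite -EFinB lee_fin cS (_ : c k + e - c k = e); last ring.
  by have := expR_ge1Dx (- (lambda * e)); lra.
(* [E k] lies in [sigma_points Pi], so by independence [P (F k)] is at most [h + lambda e] times the
   probability that [U] is in [I k]; these cells are disjoint. *)
pose F k := E k `&` U @^-1` I k.
have mF k : measurable (F k).
  by apply: measurableI => //; apply: mUI; exact: measurable_itv.
have mUab : measurable (U @^-1` ~` `[a, b]) by apply: mUI; apply: measurableC.
have mB : measurable (\big[setU/set0]_(k < n.+1) F k).
  by apply: bigsetU_measurable => k _.
rewrite -lee_fin fineK ?fin_num_measure//.
(* The cells are half-open, so the first [n] cover [[a, b)] only; one more is taken for
   [U w = b]. *)
apply: (@le_trans _ _ (P (\big[setU/set0]_(k < n.+1) F k `|`
                          U @^-1` ~` `[a, b]))).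
  apply: le_measure; [exact/mem_set|exact/mem_set/measurableU|].
  move=> w Aw; have [abU|] := pselect (`[a, b]%classic (U w)); last by right.
  move: abU; rewrite /= in_itv/= => /andP[aU Ub].
  have [||k [kn ckU]] := @ex_last_lt (fun k => c k <= U w) n.+1.
  - by rewrite /c mul0r addr0.
  - rewrite -ltNge (le_lt_trans Ub)// cS (_ : c n = b) ?ltrDl//.
    by rewrite /c /e; field; rewrite gt_eqF.
  rewrite -ltNge => Uck; left; rewrite -bigcup_mkord; exists k => //; split.
    have [v|] := pselect (void `[c k, c k.+1] w); last by right.
    by left; apply: (AH _ _ _ Aw _ v); rewrite ckU ltW.
  by rewrite /I /= in_itv/= ckU.
apply: (le_trans (measureU2 _ _ _)) => //.
rewrite /= Uab adde0; apply: (le_trans (Boole_inequality _ _)) => //.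
apply: (@le_trans _ _ (\sum_(k < n.+1) (h + lambda * e)%:E * P (U @^-1` I k))%E).
  apply: lee_sum => k _ /=; rewrite Pi_U_independent//; last exact: measurable_itv.
  by apply: lee_wpmul2r.
have he0 : (0 <= (h + lambda * e)%:E)%E by apply: le_trans (PE 0).
have -> : (h + lambda * (b - a) / n%:R)%:E = ((h + lambda * e)%:E * 1)%E.
  by rewrite mule1 /e mulrA.
rewrite -ge0_sume_distrr//; apply: lee_wpmul2l => //.
have mUk (k : 'I_n.+1) : measurable (U @^-1` I k) by apply: mUI; exact: measurable_itv.
rewrite -(@measure_bigsetU_ord_cond _ _ _ P _ _ (fun k : 'I_n.+1 => U @^-1` I k)) //.
  by apply: probability_le1; apply: bigsetU_measurable => k _.
have cle i j : (i < j)%N -> c i.+1 <= c j.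
  by move=> ij; rewrite /c lerD2l ler_wpM2r ?(ltW e0)// ler_nat.
apply/trivIsetP => i j _ _ ij; apply/seteqP; split => // w [].
rewrite /I /= !in_itv/= => /andP[i1 i2] /andP[j1 j2].
by move: ij; rewrite -val_eqE neq_ltn => /orP[] /cle; lra.
Qed.

Lemma random_gap_length_tail x : 0 <= x ->
  P [set w | (x < gap_length (Pi w) (U w))%R] =
  ((1 + lambda * x) * expR (- (lambda * x)))%:E.
Proof.
move=> x0; set A := [set w | _].
have mA : measurable A.
  apply: (@measurable_gap_length_gt _ T R Pi U) => //.
  - exact: (ppp_locally_finite ppp_Pi).
  - by move=> B mB; exact: (measurable_void ppp_Pi).
have lf := ppp_locally_finite ppp_Pi.
apply/eqP; rewrite eq_le; apply/andP; split.
  apply: (@prob_random_location_le A (fun c => [set w | x < gap_length (Pi w) c])) => //.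
  - by move=> c; exact: (sigma_points_gap_length_gt ppp_Pi).
  - by move=> c; rewrite (gap_length_tail lambda_gt0 ppp_Pi).
  - move=> w s t /= xU sUt v.
    by rewrite -(eq_gap_length v sUt)// lexx; case/andP: sUt => /le_trans; apply.
set q := (_ * _).
(* The lower bound on [P A] is the same rounding estimate applied to the complement. *)
have : (P (~` A) <= (1 - q)%:E)%E.
  apply: (@prob_random_location_le _ (fun c => ~` [set w | x < gap_length (Pi w) c])).
  - exact: measurableC.
  - by move=> c; apply: sigma_algebraC; exact: (sigma_points_gap_length_gt ppp_Pi).
  - move=> c; rewrite probability_setC ?(gap_length_tail lambda_gt0 ppp_Pi)//.
    exact: measurable_sigma_points (sigma_points_gap_length_gt ppp_Pi _ _).
  - move=> w s t /= xU sUt v.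
    by rewrite -(eq_gap_length v sUt)// lexx; case/andP: sUt => /le_trans; apply.
rewrite probability_setC// -[P A]fineK ?fin_num_measure// -EFinB !lee_fin.
by rewrite lerD2l lerN2.
Qed.

End random_location.

(** * Measures with a density, and their determination by tails *)

Section density_measure.
Context (R : realType) (f : R -> R).
Hypothesis mf : measurable_fun setT f.
Hypothesis f_ge0 : forall x, 0 <= f x.

(* The proof arguments make the measure instance below inferable. *)
Definition density_measure (_ : measurable_fun setT f) (_ : forall x, 0 <= f x)
  (A : set R) : \bar R := (\int[lebesgue_measure]_(x in A) (f x)%:E)%E.

Let nu := density_measure mf f_ge0.

Let nu0 : nu set0 = 0%E.
Proof. exact: integral_set0. Qed.

Let nu_ge0 A : (0 <= nu A)%E.
Proof. by apply: integral_ge0 => x _; rewrite lee_fin. Qed.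

Let nu_sigma_additive : semi_sigma_additive nu.
Proof.
move=> F mF tF mUF; rewrite /nu /density_measure; apply: cvg_toP.
  apply: ereal_nondecreasing_is_cvgn => m n mn.
  by apply: lee_sum_nneg_natr => // k _ _; exact: nu_ge0.
rewrite ge0_integral_bigcup//=.
- by apply/measurable_EFinP; exact: measurable_funTS.
- by move=> x _; rewrite lee_fin.
Qed.

HB.instance Definition _ := isMeasure.Build _ _ _ (density_measure mf f_ge0)
  nu0 nu_ge0 nu_sigma_additive.

End density_measure.

Section tails_and_densities.
Context d (T : measurableType d) (R : realType) (P : probability T R).
Implicit Types (X : T -> R) (f : R -> R).

(** Open rays are stable under intersection and generate the Borel sets, and the law of [X] is
    finite on rays exhausting the line, so uniqueness of measures applies. *)
Lemma has_density_tail X f : measurable_fun setT X ->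
  measurable_fun setT f -> (forall x, 0 <= f x) ->
  (forall x, P [set w | x < X w] =
             (\int[lebesgue_measure]_(y in `]x, +oo[) (f y)%:E)%E) ->
  has_density P X f.
Proof.
move=> mX mf f0 tail B mB.
pose X' : {RV P >-> R} := mfun_Sub (mem_set mX).
pose nu := density_measure mf f0.
suff : distribution P X' B = nu B by [].
have XE x : distribution P X' `]x, +oo[%classic = P [set w | x < X w].
  by congr (P _); apply/seteqP; split => w /=; rewrite in_itv/= andbT.
apply: (@measure_unique _ _ _ (@RGenOInfty.G R) (fun k : nat => `](- k%:R)%R, +oo[%classic) _ _ _ _
  (distribution P X') nu).
- exact: RGenOInfty.measurableE.
- move=> _ _ [x ->] [y ->]; exists (Num.max x y).
  by apply/seteqP; split => z /=; rewrite !in_itv/= !andbT gt_max; [move=> [-> ->]|move=> /andP].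
- by move=> k; exists (- k%:R).
- apply/seteqP; split => // x _; exists (Num.truncn `|x|).+1 => //=.
  rewrite in_itv/= andbT ltrNl (le_lt_trans (ler_norm _))// normrN.
  exact: truncnS_gt.
- by move=> _ [x ->] /=; rewrite XE tail.
- by move=> k; rewrite -ge0_fin_numE// fin_num_measure.
- exact: mB.
Qed.

End tails_and_densities.

(** * The Gamma density, its length-biased form, and the mean *)

Section gamma_density.
Context (R : realType) (lambda : R).
Hypothesis lambda_gt0 : 0 < lambda.

Let f (x : R) := if 0 <= x then lambda ^+ 2 * x * expR (- (lambda * x)) else 0.

Let f_ge0 x : 0 <= f x.
Proof.
rewrite /f; case: ifPn => // x0.
by rewrite !mulr_ge0 ?expR_ge0// ltW.
Qed.

Let mf : measurable_fun setT f.
Proof.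
apply: measurable_fun_ifT => //; first exact: measurable_fun_ler.
apply: continuous_measurable_fun => x.
apply: differentiable_continuous; apply/derivable1_diffP.
exact: ex_derive.
Qed.

Lemma integral_restrict_ge0 (g : R -> R) (A : set R) : `[0, +oo[ `<=` A ->
  (forall x, x < 0 -> g x = 0) ->
  (\int[lebesgue_measure]_(x in A) (g x)%:E =
   \int[lebesgue_measure]_(x in `[0%R, +oo[) (g x)%:E)%E.
Proof.
move=> A0 g0; rewrite integral_mkcond [RHS]integral_mkcond; apply: eq_integral => x _.
rewrite !patchE; have [x0|x0] := leP 0 x.
  by rewrite !mem_set//=; [rewrite in_itv/= x0|apply: A0; rewrite /= in_itv/= x0].
by rewrite g0//; do 2 case: ifP.
Qed.

Lemma integral_gamma_tail x : 0 <= x ->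
  (\int[lebesgue_measure]_(y in `]x, +oo[) (f y)%:E)%E =
  ((1 + lambda * x) * expR (- (lambda * x)))%:E.
Proof.
move=> x0; rewrite integral_itv_obnd_cbnd; last first.
  by apply: measurable_funTS; exact/measurable_EFinP.
transitivity (\int[lebesgue_measure]_(y in `[x, +oo[)
     ((0 + lambda ^+ 2 * y) * expR (- (lambda * y)))%:E)%E.
  apply: eq_integral => y /set_mem; rewrite /= in_itv/= andbT => xy.
  by rewrite /f (le_trans x0 xy) add0r.
rewrite integral_affine_expR//; last by rewrite exprn_ge0// ltW.
by congr EFin; field; rewrite gt_eqF.
Qed.

Lemma has_density_gamma_tail d (T : measurableType d) (P : probability T R)
    (X : T -> R) : measurable_fun setT X -> (forall w, 0 <= X w) ->
  (forall x, 0 <= x -> P [set w | x < X w] =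
     ((1 + lambda * x) * expR (- (lambda * x)))%:E) ->
  has_density P X f.
Proof.
move=> mX X0 tail; apply: has_density_tail => // x.
have [x0|x0] := leP 0 x; first by rewrite tail// integral_gamma_tail.
(* For [x < 0] the event is certain, and since [f] vanishes on negatives the integral is the tail at
   0, equal to 1. *)
rewrite (_ : [set w | _] = setT); last first.
  by apply/seteqP; split => // w _ /=; exact: lt_le_trans (X0 w).
rewrite probability_setT integral_restrict_ge0; last 2 first.
- by move=> y /=; rewrite !in_itv/= !andbT; exact: lt_le_trans.
- by move=> y y0; rewrite /f leNgt y0.
rewrite -integral_itv_obnd_cbnd; last first.
  by apply: measurable_funTS; exact/measurable_EFinP.
by rewrite integral_gamma_tail// mulr0 addr0 oppr0 expR0 mulr1.
Qed.

Lemma length_biased_exponential : f = length_biased (exponential_pdf lambda).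
Proof.
have mean : \int[lebesgue_measure]_y (y * exponential_pdf lambda y) = lambda^-1 :> R.
  rewrite /Rintegral integral_restrict_ge0//; last first.
    by move=> y y0; rewrite lt0_exponential_pdf ?mulr0.
  transitivity (fine (\int[lebesgue_measure]_(y in `[0%R, +oo[)
      ((0 + lambda * y) * expR (- (lambda * y)))%:E)%E).
    congr fine; apply: eq_integral => y /set_mem; rewrite /= in_itv/= andbT => y0.
    by rewrite exponential_pdfE// add0r mulNr; congr EFin; ring.
  rewrite integral_affine_expR ?(ltW lambda_gt0)//=.
  by rewrite mulr0 oppr0 expR0; field; rewrite gt_eqF.
apply/funext => x; rewrite /f /length_biased mean; case: ifPn => [x0|].
  by rewrite exponential_pdfE// mulNr invrK; ring.
by rewrite -ltNge => x0; rewrite lt0_exponential_pdf// mulr0 mul0r.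
Qed.

Lemma gamma_fun2 : gamma_fun 2 = 1 :> R.
Proof.
rewrite /gamma_fun /Rintegral.
transitivity (fine (\int[lebesgue_measure]_(y in `]0%R : R, +oo[)
      ((0 + 1 * y) * expR (- (1 * y)))%:E)%E).
  congr fine; apply: eq_integral => y /set_mem; rewrite /= in_itv/= andbT => y0.
  by rewrite add0r !mul1r (_ : 2 - 1 = 1) ?powRr1 ?ltW//; ring.
rewrite integral_itv_obnd_cbnd; last first.
  apply: measurable_funTS; apply/measurable_EFinP; apply: continuous_measurable_fun => x.
  apply: differentiable_continuous; apply/derivable1_diffP.
  exact: ex_derive.
rewrite integral_affine_expR//=.
by rewrite !mulr0 oppr0 expR0; field.
Qed.

Lemma gamma_pdf2E : gamma_pdf 2 lambda = f.
Proof.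
apply/funext => x; rewrite /gamma_pdf /f; case: ifPn => // x0.
rewrite gamma_fun2 divr1 (_ : 2 - 1 = 1); last ring.
by rewrite powRr1// -[2]/(2%:R) powR_mulrn// ltW.
Qed.

(** The mean of a nonnegative variable is the integral of its tail; the terms [1] and [lambda y]
    each contribute [1 / lambda]. *)
Lemma expectation_gamma_tail d (T : measurableType d) (P : probability T R)
    (X : T -> R) : measurable_fun setT X -> (forall w, 0 <= X w) ->
  (forall x, 0 <= x -> P [set w | x < X w] =
     ((1 + lambda * x) * expR (- (lambda * x)))%:E) ->
  ('E_P[X] = (2 / lambda)%:E)%E.
Proof.
move=> mX X0 tail.
pose X' : {RV P >-> R} := mfun_Sub (mem_set mX).
rewrite -[X]/(X' : T -> R) ge0_expectation_ccdf//.
transitivity (\int[lebesgue_measure]_(y in `[0%R, +oo[)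
     ((1 + lambda * y) * expR (- (lambda * y)))%:E)%E.
  apply: eq_integral => y /set_mem; rewrite /= in_itv/= andbT => y0.
  rewrite -tail//; congr (P _).
  by apply/seteqP; split => w /=; rewrite in_itv/= andbT.
rewrite integral_affine_expR ?(ltW lambda_gt0)//=.
by congr EFin; rewrite !mulr0 oppr0 expR0; field; rewrite gt_eqF.
Qed.

End gamma_density.

Theorem proposition1 (R : realType) (d : measure_display)
    (T : measurableType d) (P : probability T R)
    (lambda : R) (lambda_gt0 : 0 < lambda)
    (Pi : T -> set R) (ppp_Pi : poisson_point_process P lambda Pi)
    (a b : R) (ab : a < b) (U : {RV P >-> R})
    (U_uniform : forall B : set R, measurable B ->
      distribution P U B = uniform_prob ab B)
    (Pi_U_independent : independent_of_points P Pi U) :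
  let Xstar := fun w => gap_length (Pi w) (U w) in
  let f := fun x : R =>
    if 0 <= x then lambda ^+ 2 * x * expR (- (lambda * x)) else 0 in
  {ae P, forall w, exists l r, gap_around (Pi w) (U w) l r} /\
  measurable_fun [set: T] Xstar /\
  has_density P Xstar f /\
  f = length_biased (exponential_pdf lambda) /\
  has_density P Xstar (gamma_pdf 2 lambda) /\
  ('E_P[Xstar] = (2 / lambda)%:E)%E.
Proof.
move=> Xstar f.
have Uab : P (U @^-1` ~` `[a, b]) = 0%E.
  have -> : P (U @^-1` ~` `[a, b]) = distribution P U (~` `[a, b]) by [].
  rewrite U_uniform; last exact: measurableC.
  rewrite /uniform_prob integral0_eq// => x /= xab.
  by rewrite /uniform_pdf; case: ifP => // axb; case: xab; rewrite in_itv.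
have tail x := @random_gap_length_tail _ _ _ _ _ _ lambda_gt0 ppp_Pi _ _ _
  ab Uab Pi_U_independent x.
have X0 w : 0 <= Xstar w by exact: gap_length_ge0.
have mX : measurable_fun setT Xstar.
  apply: measurable_gap_length => //.
  - exact: ppp_locally_finite ppp_Pi.
  - by move=> A mA; exact: (measurable_void ppp_Pi).
have densX : has_density P Xstar f := has_density_gamma_tail lambda_gt0 mX X0 tail.
split; [|split; [|split; [|split; [|split]]]] => //.
(* A gap exists exactly where [Xstar] is positive, and the tail at 0 is 1. *)
- have mgap : measurable [set w | 0 < Xstar w].
    rewrite (_ : [set w | _] = Xstar @^-1` `]0, +oo[).
      by rewrite -[X in measurable X]setTI; exact: mX.
    by apply/seteqP; split => w /=; rewrite in_itv/= andbT.
  exists (~` [set w | 0 < Xstar w]); split; first exact: measurableC.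
    rewrite probability_setC// tail// mulr0 addr0 oppr0 expR0 mulr1.
    by rewrite subee.
  by move=> w /= ngap /gap_length_gt0.
- exact: length_biased_exponential.
- by rewrite gamma_pdf2E.
- by have := expectation_gamma_tail lambda_gt0 mX X0 tail.
Qed.
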